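(* Consider the following three graphs on the vertex set $\{a,b,c,x,y,z\}$: (1) $N(a)=\{c,x,y,z\}$, $N(b)=\{x,y,z\}$, $N(c)=\{a,y\}$, $N(x)=\{a,b,y,z\}$, $N(y)=\{a,b,c,x\}$, $N(z)=\{a,b,x\}$; (2) $N(a)=N(b)=\{c,x,y,z\}$, $N(c)=\{a,b,x,y\}$, $N(x)=\{a,b,c,y\}$, $N(y)=\{a,b,c,x\}$, $N(z)=\{a,b\}$; (3) $N(a)=N(b)=\{c,x,y,z\}$, $N(c)=N(z)=\{a,b,x,y\}$, $N(x)=\{a,b,c,z\}$, $N(y)=\{a,b,c,z\}$. For each of these graphs, the graph obtained by adding a new vertex $w$ and the single edge $xw$ is not a zero-divisor graph.
   Context: For a commutative semigroup $S$ with zero, its zero-divisor graph $\Gamma(S)$ has as vertices the nonzero zero-divisors of $S$, distinct $u,v$ being adjacent iff $uv=0$. A graph is a zero-divisor graph if it is isomorphic to $\Gamma(S)$ for some commutative semigroup $S$ with zero. $N(v)$ denotes the set of neighbors of $v$. (The three six-vertex graphs themselves are known to be zero-divisor graphs.) *)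

(* Defs.v *)
From HB Require Import structures.
From mathcomp Require Import all_boot.
Set Implicit Arguments.
Unset Strict Implicit.
Unset Printing Implicit Defensive.

Record sgraph := SGraph {
  vertex :> finType;
  edge : rel vertex;
  edge_sym : symmetric edge;
  edge_irrefl : irreflexive edge
}.

(* A commutative semigroup with zero is a carrier S (any type, possibly
   infinite), an associative and commutative law mul, and an element z
   with left_zero z mul. *)
Definition zero_divisor (S : Type) (mul : S -> S -> S) (z : S) (s : S) : Prop :=
  exists2 t, t <> z & mul s t = z.

Definition zdg_vertex (S : Type) (mul : S -> S -> S) (z : S) (s : S) : Prop :=
  s <> z /\ zero_divisor mul z s.

Definition zdg_adj (S : Type) (mul : S -> S -> S) (z : S) (s t : S) : Prop :=
  s <> t /\ mul s t = z.

(* The isomorphism from G to Gamma(S) is given as a map into S: a bijection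
   from the vertices of G onto the nonzero zero-divisors of S that preserves
   and reflects adjacency. *)
Definition iso_zdg (G : sgraph) (S : Type) (mul : S -> S -> S) (z : S) : Prop :=
  exists f : G -> S,
    [/\ injective f,
        forall s, zdg_vertex mul z s <-> exists v, f v = s
      & forall u v, edge u v <-> zdg_adj mul z (f u) (f v)].

Definition zero_divisor_graph (G : sgraph) : Prop :=
  exists (S : Type) (mul : SemiGroup.com_law S) (z : S),
    left_zero z mul /\ iso_zdg G mul z.

(* The new vertex is None. *)
Definition pendant_edge (G : sgraph) (p : G) : rel (option G) :=
  fun u v => match u, v with
  | Some u, Some v => edge u v
  | Some u, None => u == p
  | None, Some v => v == p
  | None, None => false
  end.

Lemma pendant_edge_sym (G : sgraph) (p : G) : symmetric (pendant_edge p).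
Proof. by move=> [u|] [v|] //=; apply: edge_sym. Qed.

Lemma pendant_edge_irrefl (G : sgraph) (p : G) : irreflexive (pendant_edge p).
Proof. by move=> [u|] //=; apply: edge_irrefl. Qed.

Definition add_pendant (G : sgraph) (p : G) : sgraph :=
  SGraph (pendant_edge_sym p) (pendant_edge_irrefl p).

Inductive six := va | vb | vc | vx | vy | vz.

Definition six_code (v : six) : 'I_6 :=
  inord (match v with
         | va => 0 | vb => 1 | vc => 2 | vx => 3 | vy => 4 | vz => 5
         end).

Definition six_decode (i : 'I_6) : six := nth va [:: va; vb; vc; vx; vy; vz] i.

Lemma six_codeK : cancel six_code six_decode.
Proof. by case; rewrite /six_decode /six_code inordK. Qed.

HB.instance Definition _ := Finite.copy six (can_type six_codeK).

Definition nbhd1 (v : six) : seq six :=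
  match v with
  | va => [:: vc; vx; vy; vz]
  | vb => [:: vx; vy; vz]
  | vc => [:: va; vy]
  | vx => [:: va; vb; vy; vz]
  | vy => [:: va; vb; vc; vx]
  | vz => [:: va; vb; vx]
  end.

Definition nbhd2 (v : six) : seq six :=
  match v with
  | va | vb => [:: vc; vx; vy; vz]
  | vc => [:: va; vb; vx; vy]
  | vx => [:: va; vb; vc; vy]
  | vy => [:: va; vb; vc; vx]
  | vz => [:: va; vb]
  end.

Definition nbhd3 (v : six) : seq six :=
  match v with
  | va | vb => [:: vc; vx; vy; vz]
  | vc | vz => [:: va; vb; vx; vy]
  | vx | vy => [:: va; vb; vc; vz]
  end.

Definition nbhd_rel (N : six -> seq six) : rel six := fun u v => v \in N u.

Lemma six_eqE (u v : six) : (u == v) =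
  match u, v with
  | va, va | vb, vb | vc, vc | vx, vx | vy, vy | vz, vz => true
  | _, _ => false
  end.
Proof. by apply/eqP; case: u v => [] []. Qed.

Lemma nbhd1_sym : symmetric (nbhd_rel nbhd1).
Proof. by case=> [] []; rewrite /nbhd_rel /= !inE !six_eqE. Qed.
Lemma nbhd1_irrefl : irreflexive (nbhd_rel nbhd1).
Proof. by case; rewrite /nbhd_rel /= !inE !six_eqE. Qed.

Lemma nbhd2_sym : symmetric (nbhd_rel nbhd2).
Proof. by case=> [] []; rewrite /nbhd_rel /= !inE !six_eqE. Qed.
Lemma nbhd2_irrefl : irreflexive (nbhd_rel nbhd2).
Proof. by case; rewrite /nbhd_rel /= !inE !six_eqE. Qed.

Lemma nbhd3_sym : symmetric (nbhd_rel nbhd3).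
Proof. by case=> [] []; rewrite /nbhd_rel /= !inE !six_eqE. Qed.
Lemma nbhd3_irrefl : irreflexive (nbhd_rel nbhd3).
Proof. by case; rewrite /nbhd_rel /= !inE !six_eqE. Qed.

Definition graph1 : sgraph := SGraph nbhd1_sym nbhd1_irrefl.
Definition graph2 : sgraph := SGraph nbhd2_sym nbhd2_irrefl.
Definition graph3 : sgraph := SGraph nbhd3_sym nbhd3_irrefl.

(* Main.v *)
Require Import Defs.
From mathcomp Require Import all_boot.
Set Implicit Arguments.
Unset Strict Implicit.
Unset Printing Implicit Defensive.

(** The nonzero zero-divisors together with 0 form an ideal, so the product of
    two vertices is 0 or a vertex whose closed neighborhood contains the
    neighborhoods of both factors; this leaves few candidates for each product.
    - Graph (1): [w w] kills neither [a] nor [y], so [w] is idempotent; hence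
      [c w] is [a] or [y] and [c c w = 0].  With [c x = x] this gives
      [c c = x], then [c z = y] and [c w = y], so that [b c w = 0] forces
      [b c = x] and [x = c x = b c c = b x = 0].
    - Graph (2): [c w], [y w] and [z w] lie in [{c, x, y}].  Each of [c], [x],
      [y] kills [c] or [y], but [z w] kills neither, as [z] does not kill
      [c w] or [y w].
    - Graph (3): [w y = x], so [w w] kills [y] and differs from [w]; being
      killed by [x], it is one of [a], [b], [c], [x], [z] and so kills [a] or
      [c], whereas [w (w a)] and [w (w c)] are nonzero because [w a] is [a] or
      [b] and [w c] is [c] or [z]. *)

Record zdg_embedding (G : sgraph) (S : Type) (mul : S -> S -> S) (o : S)
    (f : G -> S) : Prop := ZdgEmbedding {
  zdg_mulA : associative mul;
  zdg_mulC : commutative mul;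
  zdg_mul0 : left_zero o mul;
  zdg_inj : injective f;
  zdg_vertexE : forall s, zdg_vertex mul o s <-> exists v, f v = s;
  zdg_edgeE : forall u v, edge u v <-> zdg_adj mul o (f u) (f v)
}.

Lemma zdg_embeddingP (G : sgraph) : zero_divisor_graph G ->
  exists (S : Type) (mul : S -> S -> S) (o : S) (f : G -> S),
    zdg_embedding mul o f.
Proof.
move=> [S [mul [o [mul0 [f [f_inj fV fE]]]]]]; exists S, mul, o, f; split=> //.
  exact: SemiGroup.Theory.mulmA.
exact: SemiGroup.Theory.mulmC.
Qed.

Section ProductsOfVertices.

Variables (G : sgraph) (S : Type) (mul : S -> S -> S) (o : S) (f : G -> S).
Hypothesis fP : zdg_embedding mul o f.

Lemma mul_edge u v : edge u v -> mul (f u) (f v) = o.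
Proof. by case/(zdg_edgeE fP). Qed.

(** Adjacency is silent about squares, hence the condition [u != v]. *)
Lemma mul_nonedge u v : u != v -> ~~ edge u v -> mul (f u) (f v) <> o.
Proof.
move=> /eqP uv /negP nuv m0.
by apply/nuv/(zdg_edgeE fP); split=> // /(zdg_inj fP).
Qed.

(** Whatever kills a factor kills the product: this makes the product a zero-divisor, and makes [s]
    adjacent to [t] unless they coincide. *)
Lemma mul_vertex u v : mul (f u) (f v) <> o ->
  exists2 t, mul (f u) (f v) = f t
    & forall s, edge u s || edge v s -> (s == t) || edge t s.
Proof.
case: fP => mulA mulC mul0 f_inj fV fE uv0.
have fu : zdg_vertex mul o (f u) by apply/fV; exists u.
have [t Et] : exists t, f t = mul (f u) (f v).
  apply/fV; split=> //; case: fu => _ [r r0 ur0].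
  by exists r; rewrite // (mulC (f u)) -mulA ur0 mulC mul0.
exists t => // s us; case: eqVneq => //= st.
apply/fE; split=> [/f_inj/esym/eqP|]; first by apply/negP.
rewrite Et; case/orP: us => /mul_edge m0.
  by rewrite (mulC (f u)) -mulA m0 mulC mul0.
by rewrite -mulA m0 mulC mul0.
Qed.

End ProductsOfVertices.

Lemma add_pendant_eqE (G : sgraph) (p : G) (u v : add_pendant p) :
  (u == v) = match u : option G, v : option G with
             | Some u, Some v => u == v
             | None, None => true
             | _, _ => false
             end.
Proof. by case: u v => [u|] []. Qed.

Ltac compute_edge :=
  rewrite ?add_pendant_eqE /= /nbhd_rel /= ?inE ?six_eqE.

Ltac nonzero fP := by apply: (mul_nonedge fP); compute_edge.

Ltac zero fP := by apply: (mul_edge fP); compute_edge.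

(** Succeeds when [s] is a neighbor of a factor outside the closed neighborhood of the candidate. *)
Ltac refute_candidate tP s :=
  by have := tP s; compute_edge; move=> /(_ isT).

(* One subgoal for each vertex that passes the closed neighborhood test as the
   value of the product of [u] and [v]; [nz] says that the product is not 0. *)
Tactic Notation "product_cases" constr(fP) constr(u) constr(v) constr(nz)
    ident(E) :=
  let t := fresh "t" in let tP := fresh "tP" in
  have [t E tP] := mul_vertex fP (u := u) (v := v) nz;
  move: t E tP => [[]|] E tP;
  first [ refute_candidate tP (Some va) | refute_candidate tP (Some vb)
        | refute_candidate tP (Some vc) | refute_candidate tP (Some vx)
        | refute_candidate tP (Some vy) | refute_candidate tP (Some vz)
        | refute_candidate tP (None : option six) | clear tP ].

Local Notation a := (Some va).
Local Notation b := (Some vb).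
Local Notation c := (Some vc).
Local Notation x := (Some vx).
Local Notation y := (Some vy).
Local Notation z := (Some vz).
Local Notation w := (None : option six).

Lemma graph1_pendant_not_zdg :
  ~ zero_divisor_graph (add_pendant (G := graph1) vx).
Proof.
move=> /zdg_embeddingP[S [mul [o [f fP]]]].
have [mulA mulC mul0 _ _ _] := fP.
have aw : mul (f a) (f w) = f a.
  have nz : mul (f a) (f w) <> o by nonzero fP.
  by product_cases fP a w nz E.
have yw : mul (f y) (f w) = f y.
  have nz : mul (f y) (f w) <> o by nonzero fP.
  by product_cases fP y w nz E.
have cx : mul (f c) (f x) = f x.
  have nz : mul (f c) (f x) <> o by nonzero fP.
  by product_cases fP c x nz E.
have a0 : f a <> o by rewrite -aw; nonzero fP.
have y0 : f y <> o by rewrite -yw; nonzero fP.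
have x0 : f x <> o by rewrite -cx; nonzero fP.
have wwa : mul (mul (f w) (f w)) (f a) <> o.
  by rewrite -mulA (mulC _ (f a)) aw mulC aw.
have wwy : mul (mul (f w) (f w)) (f y) <> o.
  by rewrite -mulA (mulC _ (f y)) yw mulC yw.
have ww : mul (f w) (f w) = f w.
  have nz : mul (f w) (f w) <> o by move=> ww0; apply: wwa; rewrite ww0 mul0.
  product_cases fP w w nz E => //.
  - by case: wwy; rewrite E; zero fP.
  - by case: wwy; rewrite E; zero fP.
  - by case: wwa; rewrite E; zero fP.
  - by case: wwa; rewrite E; zero fP.
  - by case: wwa; rewrite E; zero fP.
have cw0 : mul (f c) (f w) <> o by nonzero fP.
have ccw : mul (mul (f c) (f c)) (f w) = o.
  rewrite -mulA; product_cases fP c w cw0 E.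
  - by rewrite E; zero fP.
  (* By idempotence, [c w = x] would give [c w = (c w) w = x w = 0]. *)
  - by case: cw0; rewrite -ww mulA E; zero fP.
  - by rewrite E; zero fP.
have ccx : mul (mul (f c) (f c)) (f x) = f x by rewrite -mulA !cx.
have cc : mul (f c) (f c) = f x.
  have nz : mul (f c) (f c) <> o by move=> cc0; apply: x0; rewrite -ccx cc0 mul0.
  product_cases fP c c nz E => //.
  - by case: x0; rewrite -ccx E; zero fP.
  - by case: cw0; rewrite -ccw E.
  - by case: x0; rewrite -ccx E; zero fP.
have cz : mul (f c) (f z) = f y.
  have nz : mul (f c) (f z) <> o by nonzero fP.
  product_cases fP c z nz E => //.
  by case: x0; rewrite -cx -E mulA cc; zero fP.
have cw : mul (f c) (f w) = f y.
  product_cases fP c w cw0 E => //.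
  (* If [c w = a], then [y = y w = (c z) w = (c w) z = a z = 0]. *)
  - case: y0; rewrite -yw -cz -mulA (mulC (f z)) mulA E; zero fP.
  - by case: cw0; rewrite -ww mulA E; zero fP.
have bc0 : mul (f b) (f c) <> o by nonzero fP.
product_cases fP b c bc0 bc.
- by case: a0; rewrite -aw -bc -mulA cw; zero fP.
- by case: x0; rewrite -cx mulC -bc -mulA cc; zero fP.
Qed.

Lemma graph2_pendant_not_zdg :
  ~ zero_divisor_graph (add_pendant (G := graph2) vx).
Proof.
move=> /zdg_embeddingP[S [mul [o [f fP]]]].
have [mulA mulC _ _ _ _] := fP.
have czw : mul (f c) (mul (f z) (f w)) <> o.
  have nz : mul (f c) (f w) <> o by nonzero fP.
  (* Regrouped as [(c w) z]: no candidate for [c w] is adjacent to [z]. *)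
  by rewrite (mulC (f z)) mulA; product_cases fP c w nz E; rewrite E; nonzero fP.
have yzw : mul (f y) (mul (f z) (f w)) <> o.
  have nz : mul (f y) (f w) <> o by nonzero fP.
  by rewrite (mulC (f z)) mulA; product_cases fP y w nz E; rewrite E; nonzero fP.
have zw0 : mul (f z) (f w) <> o by nonzero fP.
product_cases fP z w zw0 zw.
- by case: yzw; rewrite zw; zero fP.
- by case: yzw; rewrite zw; zero fP.
- by case: czw; rewrite zw; zero fP.
Qed.

Lemma graph3_pendant_not_zdg :
  ~ zero_divisor_graph (add_pendant (G := graph3) vx).
Proof.
move=> /zdg_embeddingP[S [mul [o [f fP]]]].
have [mulA mulC mul0 _ _ _] := fP.
have wy0 : mul (f w) (f y) <> o by nonzero fP.
have wwy : mul (mul (f w) (f w)) (f y) = o.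
  by rewrite -mulA; product_cases fP w y wy0 E; rewrite E; zero fP.
have wwa : mul (mul (f w) (f w)) (f a) <> o.
  have nz : mul (f w) (f a) <> o by nonzero fP.
  by rewrite -mulA; product_cases fP w a nz E; rewrite E; nonzero fP.
have wwc : mul (mul (f w) (f w)) (f c) <> o.
  have nz : mul (f w) (f c) <> o by nonzero fP.
  by rewrite -mulA; product_cases fP w c nz E; rewrite E; nonzero fP.
have ww0 : mul (f w) (f w) <> o by move=> ww; apply: wwa; rewrite ww mul0.
product_cases fP w w ww0 ww.
- by case: wwc; rewrite ww; zero fP.
- by case: wwc; rewrite ww; zero fP.
- by case: wwa; rewrite ww; zero fP.
- by case: wwa; rewrite ww; zero fP.
- by case: wwa; rewrite ww; zero fP.
(* If [w w = w], then [w y = (w w) y = 0]. *)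
- by case: wy0; rewrite -wwy ww.
Qed.

Theorem theorem5p1 :
  [/\ ~ zero_divisor_graph (add_pendant (G := graph1) vx),
      ~ zero_divisor_graph (add_pendant (G := graph2) vx)
    & ~ zero_divisor_graph (add_pendant (G := graph3) vx)].
Proof.
split.
- exact: graph1_pendant_not_zdg.
- exact: graph2_pendant_not_zdg.
- exact: graph3_pendant_not_zdg.
Qed.
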